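(* Let $\mathbf{k}$ be a multi-index with $\operatorname{wt}(\mathbf{k})=-1$. Then $$F_{\mathbf{k}}=\sum_{a\in A}\ \sum_{\substack{j\ge -1\\ k_j^a\ge 1}}\ \sum_{\substack{\nu=(\nu_{\boldsymbol\ell})_{\boldsymbol\ell\in\mathcal{K}_{-1}}\ \text{finitely supported}\\ |\nu|=j+1,\ \Sigma(\nu)=\mathbf{k}-\mathbf{e}_j^a}}\ \prod_{\boldsymbol\ell\in\mathcal{K}_{-1}}\operatorname{Mlt}(F_{\boldsymbol\ell},\nu_{\boldsymbol\ell}).$$ The product is finite because $\nu$ is finitely supported.
   Context: $A$ is a finite set (of decorations) and $I_A:=A\times\mathbb{Z}_{\ge -1}$. A multi-index is a finitely supported map $\mathbf{k}:I_A\to\mathbb{Z}_{\ge 0}$, written $k_j^a:=\mathbf{k}(a,j)$; set $|\mathbf{k}|=\sum_{a,j}k_j^a$ and $\operatorname{wt}(\mathbf{k})=\sum_{a,j}j\,k_j^a$ (sums over $a\in A$, $j\ge -1$). $\mathbf{e}_j^a$ is the multi-index with $(a,j)$-coordinate $1$ and all other coordinates $0$; sums and differences are componentwise. An $A$-decorated rooted tree is a finite rooted tree $t$ with a map $d:V(t)\to A$; isomorphisms preserve the root and the decorations. The fertility $f(v)$ of a vertex $v$ is its number of children. The profile of $t$ is the multi-index $\mathbf{k}(t)$ with $k_j^a(t)=\#\{v\in V(t): d(v)=a,\ f(v)=j+1\}$. Let $\mathcal{F}_{\mathbf{k}}$ be the (finite) set of isomorphism classes of $A$-decorated rooted trees with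 profile $\mathbf{k}$, and $F_{\mathbf{k}}:=|\mathcal{F}_{\mathbf{k}}|$. Let $\mathcal{K}_{-1}$ be the set of all multi-indices $\boldsymbol\ell$ with $\operatorname{wt}(\boldsymbol\ell)=-1$. For a finitely supported family $\nu=(\nu_{\boldsymbol\ell})_{\boldsymbol\ell\in\mathcal{K}_{-1}}$ of nonnegative integers, put $|\nu|:=\sum_{\boldsymbol\ell}\nu_{\boldsymbol\ell}$ and $\Sigma(\nu):=\sum_{\boldsymbol\ell}\nu_{\boldsymbol\ell}\,\boldsymbol\ell$ (a multi-index). For $r,m\in\mathbb{Z}_{\ge 0}$, $\operatorname{Mlt}(r,m):=[z^m](1-z)^{-r}$, i.e. $\binom{r+m-1}{m}$ if $r\ge 1$ and $\delta_{0,m}$ if $r=0$. *)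

(* Defs.v *)
From HB Require Import structures.
From mathcomp Require Import all_boot all_order all_algebra all_fingroup.
From mathcomp Require Import finmap.
From mathcomp Require Import boolp.

Set Implicit Arguments.
Unset Strict Implicit.
Unset Printing Implicit Defensive.

Import Order.TTheory GRing.Theory Num.Theory.

Definition zgem1 : Type := {j : int | (-1 <= j)%R}.
HB.instance Definition _ := [isSub of zgem1 for @sval int _].
HB.instance Definition _ := [Choice of zgem1 by <:].

Definition multiindex (A : finType) : Type :=
  {fsfun (A * zgem1)%type -> nat with 0%N}.
HB.instance Definition _ (A : finType) := Choice.on (multiindex A).

Section MultiIndex.
Variable A : finType.
Implicit Types (k : multiindex A) (p q : A * zgem1).

Definition mlen k : nat := \sum_(p <- finsupp k) k p.

Definition mwt k : int := (\sum_(p <- finsupp k) val p.2 * (k p)%:Z)%R.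

Definition munit p q : nat := (q == p).

End MultiIndex.

Definition Kminus1 (A : finType) : Type :=
  {l : multiindex A | mwt l == (-1)%R}.
HB.instance Definition _ (A : finType) :=
  [isSub of Kminus1 A for @sval (multiindex A) _].
HB.instance Definition _ (A : finType) := [Choice of Kminus1 A by <:].

Definition kfamily (A : finType) : Type := {fsfun Kminus1 A -> nat with 0%N}.
HB.instance Definition _ (A : finType) := Choice.on (kfamily A).

Section Families.
Variable A : finType.
Implicit Types nu : kfamily A.

Definition fam_size nu : nat := \sum_(l <- finsupp nu) nu l.

Definition fam_sum nu (q : A * zgem1) : nat :=
  \sum_(l <- finsupp nu) nu l * val l q.

End Families.

(* Raw data on a vertex set V: a digraph whose arcs (u, v) are to be read
   "v is a child of u", a distinguished vertex, and a decoration. *)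
Notation predtree A V := ({set V * V} * V * {ffun V -> A})%type.

Section Trees.
Variables A V : finType.
Implicit Types t : predtree A V.

Definition arcs t : {set V * V} := t.1.1.
Definition troot t : V := t.1.2.
Definition decor t : {ffun V -> A} := t.2.

Definition is_child t : rel V := fun u v => (u, v) \in arcs t.

(* Rooted trees are the digraphs in which every vertex is reachable from the
   root, the root has no parent and every other vertex has exactly one. *)
Definition is_tree t : bool :=
  [forall v, connect (is_child t) (troot t) v] &&
  [forall v, #|[set u | is_child t u v]| == (v != troot t)].

Definition fertility t (v : V) : nat := #|[set w | is_child t v w]|.

Definition has_profile t (k : multiindex A) : Prop :=
  forall (a : A) (j : zgem1),
    k (a, j) =
    #|[set v | (decor t v == a) && ((fertility t v)%:Z == val j + 1)%R]|.

Definition tree_iso t t' : bool :=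
  [exists f : {perm V},
    [&& f (troot t) == troot t',
        [forall u, forall v, is_child t' (f u) (f v) == is_child t u v]
      & [forall v, decor t' (f v) == decor t v]]].

End Trees.

(* A tree with profile k has exactly [mlen k] vertices, so every isomorphism
   class has a representative whose vertex set is 'I_(mlen k). *)
Definition trees_of_profile (A : finType) (k : multiindex A) :
    {set predtree A 'I_(mlen k)} :=
  [set t | is_tree t && `[< has_profile t k >]].

Definition tree_classes (A : finType) (k : multiindex A) :
    {set {set predtree A 'I_(mlen k)}} :=
  equivalence_partition (@tree_iso A 'I_(mlen k)) (trees_of_profile k).

Definition num_trees (A : finType) (k : multiindex A) : nat :=
  #|tree_classes k|.

(* The coefficient of z^m in (1 - z)^(-r). *)
Definition Mlt (r m : nat) : nat :=
  if r == 0%N then nat_of_bool (m == 0%N) else 'C(r + m - 1, m).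

(* Main.v *)
Require Import Defs.
From HB Require Import structures.
From mathcomp Require Import all_boot all_order all_algebra all_fingroup.
From mathcomp Require Import finmap zify.
From mathcomp Require Import boolp classical_sets fsbigop.

(** Sort the children of every vertex, recursively, along a fixed total order:
    the resulting ordered tree is a complete isomorphism invariant, so [F_k]
    counts the canonical ordered trees of profile [k].  Every tree has weight
    [-1], hence removing a root labelled [(a, j)] leaves a multiset of [j + 1]
    canonical trees whose profiles lie in [K_{-1}] and add up to [k - e_j^a];
    [nu_l] is the number of trees of profile [l] in it, and there are
    [Mlt (F_l, nu_l)] multisets of [nu_l] trees among [F_l]. *)

Set Implicit Arguments.
Unset Strict Implicit.
Unset Printing Implicit Defensive.

Import Order.TTheory GRing.Theory Num.Theory.

Local Open Scope nat_scope.

(** * Enumerating finite multisets as sequences up to permutation *)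

Section Multisets.
Variable T : eqType.
Implicit Types (U s u : seq T) (E : seq (seq T)).

(** The head of [U] is either taken once more or discarded for good. Each call shortens [U] or
    lowers [m], and the nested [fix] makes this structural. *)
Fixpoint multisets U : nat -> seq (seq T) :=
  if U isn't x :: U' then fun m => nseq (m == 0) [::] else
  fix aux m := if m isn't m'.+1 then [:: [::]]
               else map (cons x) (aux m') ++ multisets U' m.

Lemma MltS r m : Mlt r.+1 m = 'C(r + m, m).
Proof. by rewrite /Mlt /= addSn subn1. Qed.

(** The recursion of [multisets] is Pascal's rule for [Mlt]; an empty tail is treated apart, since
    [Mlt 0] is a Kronecker delta and not a binomial. *)
Lemma size_multisets U m : size (multisets U m) = Mlt (size U) m.
Proof.
elim: U m => [|x U IHU] m /=; first by rewrite size_nseq /Mlt.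
elim: m => [|m IHm] /=; first by rewrite MltS bin0.
rewrite size_cat size_map IHm [size (multisets U _)]IHU !MltS.
case: (size U) => [|r]; first by rewrite /Mlt /= !add0n !binn.
by rewrite MltS addSnnS addSn binS addnC.
Qed.

Lemma perm_eqs0 s : perm_eq s [::] = (s == [::]).
Proof. exact/perm_nilP/eqP. Qed.

Lemma count_perm_eq_cons x s E :
  count (perm_eq s) (map (cons x) E) =
  if x \in s then count (perm_eq (rem x s)) E else 0.
Proof.
rewrite count_map; case: ifPn => xs.
  by apply: eq_count => u /=; rewrite (permPl (perm_to_rem xs)) perm_cons.
rewrite (@eq_count _ _ pred0) ?count_pred0 // => u /=.
by apply: contraNF xs => /perm_mem->; rewrite mem_head.
Qed.

(* [multisets U m] meets exactly once every permutation class of sequences of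
   length [m] over [U]. *)
Lemma count_multisets U m s : uniq U ->
  count (perm_eq s) (multisets U m) = (all [in U] s && (size s == m)).
Proof.
elim: U m s => [|x U IHU] m s /=.
  case: m => [|m] /=; last by case: s.
  by rewrite addn0 perm_eqs0; case: s.
case/andP=> xU uU; elim: m s => [|m IHm] s /=.
  by rewrite addn0 perm_eqs0 size_eq0; case: s => //= y s; rewrite andbF.
rewrite count_cat count_perm_eq_cons IHU //; case: ifPn => xs.
  rewrite IHm; have -> : all [in U] s = false.
    by apply: contraNF xU => /allP/(_ x xs).
  rewrite addn0 size_rem // (perm_all _ (perm_to_rem xs)) /= mem_head /=.
  by case: (s) xs => //= y s'; rewrite eqSS.
rewrite add0n; congr (nat_of_bool (_ && _)); apply: eq_in_all => y ys.
by rewrite /= inE; case: eqP ys xs => // -> ->.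
Qed.

(** The predicate [a] tells the entries of [u1] from those of [u2], so [s] is a permutation of
    [u1 ++ u2] exactly when its two filtered halves match separately. *)
Lemma count_perm_eq_allpairs (a : pred T) E1 E2 s :
    all (all a) E1 -> all (all (predC a)) E2 ->
  count (perm_eq s) [seq u1 ++ u2 | u1 <- E1, u2 <- E2] =
  count (perm_eq (filter a s)) E1 * count (perm_eq (filter (predC a) s)) E2.
Proof.
move=> aE1 aE2; elim: E1 aE1 => //= u1 E1 IH /andP[au1 /IH{IH}aE1].
rewrite count_cat aE1 mulnDl; congr (_ + _); rewrite count_map.
have fu2 u2 : u2 \in E2 -> perm_eq s (u1 ++ u2) =
   perm_eq (filter a s) u1 && perm_eq (filter (predC a) s) u2.
  move=> /(allP aE2) au2; apply/idP/andP => [ps|[p1 p2]]; last first.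
    by rewrite -(perm_filterC a s) perm_cat.
  have := (perm_filter a ps, perm_filter (predC a) ps).
  rewrite !filter_cat (all_filterP au1) (all_filterP au2).
  have -> : filter a u2 = [::].
    by apply/eqP; rewrite -[_ == _]negbK -has_filter -all_predC.
  have -> : filter (predC a) u1 = [::].
    apply/eqP; rewrite -[_ == _]negbK -has_filter has_predC negbK.
    exact: au1.
  by rewrite cats0 => -[].
rewrite (eq_in_count fu2).
by case: (perm_eq _ u1); rewrite /= ?mul1n // count_pred0.
Qed.

Variables (L : eqType) (f : T -> L) (C : L -> seq T) (nu : L -> nat).

Definition multifamilies (ls : seq L) : seq (seq T) :=
  foldr (fun l E => [seq u1 ++ u2 | u1 <- multisets (C l) (nu l), u2 <- E])
        [:: [::]] ls.

Lemma size_multifamilies ls :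
  size (multifamilies ls) = \prod_(l <- ls) Mlt (size (C l)) (nu l).
Proof.
elim: ls => [|l ls IH] /=; first by rewrite big_nil.
by rewrite big_cons size_allpairs IH size_multisets.
Qed.

Hypothesis CP : forall l, uniq (C l).
Variable P : pred T.
Hypothesis memC : forall l x, (x \in C l) = P x && (f x == l).

Lemma multisets_sub U m u : uniq U -> u \in multisets U m -> all [in U] u.
Proof.
move=> uU uM; have: 0 < count (perm_eq u) (multisets U m).
  by rewrite -has_count; apply/hasP; exists u.
by rewrite count_multisets //; case: all.
Qed.

Lemma multifamilies_sub ls u :
  u \in multifamilies ls -> all (fun x => f x \in ls) u.
Proof.
elim: ls u => [|l ls IH] u /=; first by rewrite inE => /eqP->.
case/allpairsP=> -[u1 u2] [/= /(multisets_sub (CP l)) u1P /IH u2P ->].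
rewrite all_cat; apply/andP; split.
  by apply: sub_all u1P => x; rewrite !inE /= memC => /andP[_ ->].
by apply: sub_all u2P => x; rewrite !inE orbC => ->.
Qed.

(** The lists [C l] are the fibres of [f] on [P], hence disjoint. The entries of [s] in the first
    fibre are handled by [count_multisets], the others by induction. *)
Lemma count_multifamilies ls s : uniq ls ->
  count (perm_eq s) (multifamilies ls) =
  [&& all P s, all (fun x => f x \in ls) s
    & all (fun l => count_mem l (map f s) == nu l) ls].
Proof.
elim: ls s => [|l ls IH] s /=.
  by rewrite addn0 perm_eqs0 andbT; case: s => [|x s] //=; rewrite andbF.
case/andP=> lls uls; rewrite (count_perm_eq_allpairs (a := fun x => f x == l)).
- rewrite count_multisets // IH // mulnb; congr nat_of_bool.
  rewrite size_filter count_map !all_filter.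
  have -> : all (fun l0 => count_mem l0
        (map f (filter (predC (fun x => f x == l)) s)) == nu l0) ls = all (fun l0 => count_mem l0 (map f s) == nu l0) ls.
    apply: eq_in_all => l0 l0ls; rewrite !count_map count_filter.
    congr (_ == _); apply: eq_count => x /=; rewrite andb_idr //.
    by move=> /eqP->; apply: contraNneq lls => <-.
  have -> : all P s = all (fun x => (f x == l) ==> P x) s
                      && all (fun x => (f x != l) ==> P x) s.
    by rewrite -all_predI; apply: eq_all => x /=; case: (f x == l); rewrite ?andbT.
  have -> : all (fun x => f x \in l :: ls) s =
            all (fun x => (f x != l) ==> (f x \in ls)) s.
    by apply: eq_all => x /=; rewrite inE; case: (f x == l).
  have -> : all [pred x | (f x == l) ==> (x \in C l)] s =
            all (fun x => (f x == l) ==> P x) s.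
    by apply: eq_all => x /=; rewrite memC; case: (f x == l); rewrite ?andbT.
  have shuffle b1 b2 b3 b4 b5 :
    [&& b1 && b2, b3, b4 & b5] = [&& b1 && b3, b4, b2 & b5].
    by case: b1 b2 b3 b4 => -[] [] [].
  exact: shuffle.
- apply/allP=> u /(multisets_sub (CP l)).
  by apply: sub_all => x; rewrite memC => /andP[].
apply/allP=> u /multifamilies_sub; apply: sub_all => x /= fx.
by apply: contraNneq lls => <-.
Qed.

End Multisets.

(** * Multiplicity functions of sequences *)

Section Tally.
Variable T : choiceType.
Implicit Type s : seq T.

Definition tally s : {fsfun T -> nat with 0} :=
  [fsfun x in [fset x in s]%fset => count_mem x s].

Lemma tallyE s x : tally s x = count_mem x s.
Proof. by rewrite fsfunE inE /=; case: ifPn => // /count_memPn. Qed.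

Lemma mem_finsupp_tally s x : (x \in finsupp (tally s)) = (x \in s).
Proof. by rewrite mem_finsupp tallyE -lt0n -has_count has_pred1. Qed.

(** The codomain is general because both integer weights and natural sizes are summed this way. *)
Lemma sum_finsupp_tally (V : nmodType) s (F : T -> V) :
  (\sum_(x <- finsupp (tally s)) F x *+ tally s x = \sum_(x <- s) F x)%R.
Proof.
rewrite -[RHS]big_undup_iterop_count.
rewrite (perm_big (undup s)) /=.
  by apply: eq_bigr => x _; rewrite tallyE.
apply: uniq_perm; rewrite ?undup_uniq ?fset_uniq // => x.
by rewrite mem_finsupp_tally mem_undup.
Qed.

Lemma sum_finsupp_tally_nat s (F : T -> nat) :
  \sum_(x <- finsupp (tally s)) tally s x * F x = \sum_(x <- s) F x.
Proof.
rewrite -(@sum_finsupp_tally nat s F); apply: eq_bigr => x _.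
by rewrite mulnC; elim: (tally s x) => [|n IH];
  rewrite ?muln0 // mulrS -IH mulnS.
Qed.

End Tally.

(** * The shift from the number of children to the index in the profile *)

Section Arity.

Fact arity_subproof n : (-1 <= n%:Z - 1 :> int)%R.
Proof. by lia. Qed.

Definition arity n : zgem1 := Sub (n%:Z - 1)%R (arity_subproof n).

Lemma arity_eq n (j : zgem1) : (arity n == j) = (n%:Z == val j + 1)%R.
Proof. by rewrite -val_eqE /=; lia. Qed.

End Arity.

(** * Ordered decorated trees, their canonical form and their profiles *)

Section Codes.
Variable A : finType.

Inductive rtree := Node of A & seq rtree.

Definition rlabel c := let: Node a _ := c in a.
Definition children c := let: Node _ s := c in s.

(** The nested list calls for an induction principle that reaches the children. They are addressed
    by index because [rtree] has no decidable equality yet. *)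
Lemma rtree_nth_ind (P : rtree -> Prop) :
    (forall a s, (forall i, i < size s -> P (nth (Node a [::]) s i)) ->
       P (Node a s)) ->
  forall c, P c.
Proof.
move=> PN; fix IH 1 => -[a s]; apply: PN.
(* Automation could close this case with [IH] on a term that is not structurally smaller, which the
   guard condition rejects. *)
elim: s => [|c s IHs]; first by clear IH.
by case=> [_|i]; [apply: IH | apply: IHs].
Qed.

Fixpoint rtree_enc c : GenTree.tree A :=
  let: Node a s := c in
  GenTree.Node 0 (GenTree.Leaf a :: map rtree_enc s).

Fixpoint rtree_dec (g : GenTree.tree A) : option rtree :=
  if g is GenTree.Node _ (GenTree.Leaf a :: s)
  then Some (Node a (pmap rtree_dec s)) else None.

Lemma rtree_encK : pcancel rtree_enc rtree_dec.
Proof.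
elim/rtree_nth_ind => a s IH /=; congr (Some (Node _ _)).
elim: s IH => //= c s IHs IH; rewrite (IH 0) //= IHs // => i.
exact: (IH i.+1).
Qed.

HB.instance Definition _ := Countable.copy rtree (pcan_type rtree_encK).

(** An arbitrary total order, pulled back from the integers along the countable encoding; its
    relation to the tree structure is immaterial. *)
Definition rle : rel rtree := relpre choice.pickle leq.

Lemma rle_total : total rle. Proof. by move=> x y; apply: leq_total. Qed.
Lemma rle_trans : transitive rle.
Proof. by move=> x y z; apply: leq_trans. Qed.
Lemma rle_anti : antisymmetric rle.
Proof. by move=> x y /anti_leq/(pcan_inj choice.pickleK). Qed.

Fixpoint canonical c :=
  let: Node _ s := c in sorted rle s && all canonical s.

Fixpoint labels c : seq (A * zgem1) :=
  let: Node a s := c in (a, arity (size s)) :: flatten (map labels s).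

Definition profile c : multiindex A := tally (labels c).

Lemma mlen_profile c : mlen (profile c) = size (labels c).
Proof.
rewrite /mlen -sum1_size -(sum_finsupp_tally_nat (labels c)).
by apply: eq_bigr => x _; rewrite muln1.
Qed.

(** A root with [n] children contributes [n - 1], and by induction each of its [n] subtrees
    contributes [-1]. *)
Lemma mwt_profile c : mwt (profile c) = (-1)%R.
Proof.
rewrite /mwt; transitivity (\sum_(p <- labels c) val p.2)%R.
  rewrite -(sum_finsupp_tally (labels c)); apply: eq_bigr => p _.
  by rewrite pmulrn mulrzz.
elim/rtree_nth_ind: c => a s IH; rewrite /= big_cons /= big_flatten big_map.
rewrite (big_nth (Node a [::])) big_mkord.
under eq_bigr => i _ do rewrite IH //.
by rewrite sumr_const card_ord; lia.
Qed.

Definition profileK c : Kminus1 A := Sub (profile c) (introT eqP (mwt_profile c)).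

Definition family c : kfamily A := tally (map profileK (children c)).

Lemma fam_size_family c : fam_size (family c) = size (children c).
Proof.
rewrite -(size_map profileK) -sum1_size.
rewrite -(sum_finsupp_tally_nat (map _ _)) /fam_size.
by apply: eq_bigr => x _; rewrite muln1.
Qed.

Lemma profile_Node a s q :
  profile (Node a s) q =
  munit (a, arity (size s)) q + fam_sum (family (Node a s)) q.
Proof.
rewrite /fam_sum sum_finsupp_tally_nat big_map tallyE /= /munit eq_sym.
congr (_ + _); rewrite count_flatten -map_comp sumnE big_map.
by apply: eq_bigr => c _; rewrite /= tallyE.
Qed.

End Codes.

(** * The canonical ordered tree of a rooted digraph *)

Section Tree.
Variables (A V : finType) (t : predtree A V).

Definition kids v := [seq w <- enum V | is_child t v w].

Lemma mem_kids v w : (w \in kids v) = is_child t v w.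
Proof. by rewrite mem_filter mem_enum andbT. Qed.

Lemma kids_uniq v : uniq (kids v).
Proof. exact/filter_uniq/enum_uniq. Qed.

Lemma size_kids v : size (kids v) = fertility t v.
Proof.
rewrite /fertility -(card_uniqP (kids_uniq v)).
by apply: eq_card => w; rewrite inE mem_kids.
Qed.

(** A digraph offers no structural recursion, so [n] is fuel; [#|V|] suffices because depths in a
    tree stay below it. *)
Fixpoint code_upto n v : rtree A :=
  Node (decor t v)
    (if n is n'.+1 then sort (@rle A) [seq code_upto n' w | w <- kids v]
     else [::]).

Definition code := code_upto #|V| (troot t).

Lemma canonical_code : canonical code.
Proof.
rewrite /code; elim: #|V| (troot t) => [|n IHn] v //=.
rewrite (sort_sorted (@rle_total A)) /= all_sort all_map.
by apply/allP => w _; apply: IHn.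
Qed.

Hypothesis ht : is_tree t.

Lemma root_not_child u : ~~ is_child t u (troot t).
Proof.
case/andP: ht => _ /forallP/(_ (troot t)); rewrite eqxx cards_eq0.
by apply: contraL => ur; apply/set0Pn; exists u; rewrite inE.
Qed.

Lemma parent_uniq u u' v : is_child t u v -> is_child t u' v -> u = u'.
Proof.
case/andP: ht => _ /forallP/(_ v) + uv u'v.
have [vr|_] := eqVneq v (troot t).
  by move: uv; rewrite vr (negPf (root_not_child u)).
case/cards1P => w /setP E; have := (E u, E u'); rewrite !inE uv u'v.
by case=> /esym/eqP-> /esym/eqP->.
Qed.

Lemma tree_ind (P : V -> Prop) :
  P (troot t) -> (forall u v, is_child t u v -> P u -> P v) -> forall v, P v.
Proof.
move=> Pr PS v; case/andP: ht => /forallP/(_ v)/connectP[p + ->] _.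
elim/last_ind: p => //= p w IHp; rewrite rcons_path last_rcons.
by case/andP=> /IHp Pp /PS; apply.
Qed.

(** Both paths are peeled from their last vertex: parents are unique, and the root has none. *)
Lemma root_path_uniq p q :
    path (is_child t) (troot t) p -> path (is_child t) (troot t) q ->
  last (troot t) p = last (troot t) q -> p = q.
Proof.
elim/last_ind: p q => [|p x IHp] q; case/lastP: q => [|q y] //.
- rewrite rcons_path last_rcons /= => _ /andP[_ yr] ry.
  by move: yr; rewrite -ry (negPf (root_not_child _)).
- rewrite rcons_path last_rcons /= => /andP[_ yr] _ ry.
  by move: yr; rewrite ry (negPf (root_not_child _)).
rewrite !rcons_path !last_rcons => /andP[pp px] /andP[pq qy] xy.
by rewrite xy (IHp q) //; apply: parent_uniq px _; rewrite xy.
Qed.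

(** The depth is the length of the unique path from the root. *)
Lemma depth_exists : exists d : V -> nat,
  [/\ d (troot t) = 0, forall u v, is_child t u v -> d v = (d u).+1
    & forall v, d v < #|V|].
Proof.
have cP v : exists p, path (is_child t) (troot t) p /\ v = last (troot t) p.
  case/andP: ht => /forallP/(_ v)/connectP[p pp lp] _; by exists p.
have [p pP] := choice cP; exists (fun v => size (p v)); split=> [|u v uv|v].
- have [pr lr] := pP (troot t); by rewrite (@root_path_uniq (p (troot t)) [::]).
- have [[pu lu] [pv lv]] := (pP u, pP v).
  rewrite (@root_path_uniq (p v) (rcons (p u) v)) ?size_rcons //.
    by rewrite rcons_path pu -lu.
  by rewrite last_rcons.
have [pv lv] := pP v.
(* Shortening gives a path without repeated vertices; by uniqueness it is [p v] itself, whose length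
   is thus bounded by the number of vertices. *)
have [q [qpath quniq lq]] : exists q, [/\ path (is_child t) (troot t) q,
    uniq (troot t :: q) & v = last (troot t) q].
  by move: lv; case: (shortenP pv) => q; exists q.
rewrite (root_path_uniq pv qpath) -?lv //.
rewrite -[(size _).+1]/(size (troot t :: q)) -(card_uniqP quniq).
exact: max_card.
Qed.

(** Giving [v] the fuel [#|V| - d v], which is positive and drops by one at each child, turns
    [code_upto] into a recursive equation without fuel. *)
Lemma code_spec : exists T : V -> rtree A,
  T (troot t) = code /\
  forall v, T v = Node (decor t v) (sort (@rle A) [seq T w | w <- kids v]).
Proof.
have [d [dr dS dV]] := depth_exists.
exists (fun v => code_upto (#|V| - d v) v); split; first by rewrite dr subn0.
move=> v; have := dV v; rewrite -subn_gt0; case E: (#|V| - d v) => [|n] //= _.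
congr (Node _ (sort _ _)); apply/eq_in_map => w; rewrite mem_kids => /dS->.
by rewrite subnS E.
Qed.

End Tree.

(** * Isomorphisms between trees on possibly different vertex sets, and invariance of the code *)

Definition isomorphism (A V V' : finType) (t : predtree A V) (t' : predtree A V')
    (f : V -> V') : Prop :=
  [/\ bijective f, f (troot t) = troot t',
      forall u v, is_child t' (f u) (f v) = is_child t u v
    & forall v, decor t' (f v) = decor t v].

Section Isomorphism.
Variables (A V V' : finType) (t : predtree A V) (t' : predtree A V').

Lemma perm_kids f v : isomorphism t t' f ->
  perm_eq (kids t' (f v)) (map f (kids t v)).
Proof.
case=> -[g fK gK] _ fc _; apply: uniq_perm; rewrite ?kids_uniq //.
  by rewrite map_inj_uniq ?kids_uniq //; apply: can_inj fK.
move=> w; rewrite mem_kids -[w in LHS]gK fc -mem_kids.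
by rewrite -(mem_map (can_inj fK)) gK.
Qed.

(** An isomorphism permutes the lists of children, and sorting forgets the permutation; the
    induction is on the fuel. *)
Lemma isomorphism_code f : isomorphism t t' f -> code t = code t'.
Proof.
move=> tf; have [/bij_eq_card cV fr fc fd] := tf.
rewrite /code cV -fr; elim: #|V'| (troot t) => [|n IHn] v /=; rewrite fd //.
congr (Node _ _); apply/perm_sortP; [exact: rle_total | exact: rle_trans
  | exact: rle_anti |].
rewrite perm_sym (permPl (perm_map _ (perm_kids v tf))) -map_comp.
by rewrite (eq_map (g := code_upto t n)) // => w; rewrite /= IHn.
Qed.

Lemma isomorphism_label f v : isomorphism t t' f ->
  (decor t' (f v), arity (fertility t' (f v))) =
  (decor t v, arity (fertility t v)).
Proof.
move=> tf; have [_ _ _ ->] := tf.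
by rewrite -!size_kids (perm_size (perm_kids v tf)) size_map.
Qed.

End Isomorphism.

(** * Completeness of the code as an isomorphism invariant *)

Section CodeIsomorphism.
Variable A : finType.

Definition sorted_kids (V : finType) (t : predtree A V) (T : V -> rtree A) v :=
  sort (relpre T (@rle A)) (kids t v).

(** The map is built from the root downwards: the child at a given place in the sorted list at [v]
    goes to the child at the same place at [f v]. Matching by place also settles ties between
    children of equal code. *)
Lemma code_descent (V V' : finType) (t : predtree A V) (t' : predtree A V')
    (T : V -> rtree A) (T' : V' -> rtree A) :
    is_tree t ->
    (forall v, T v = Node (decor t v) (sort (@rle A) (map T (kids t v)))) ->
    (forall v, T' v = Node (decor t' v) (sort (@rle A) (map T' (kids t' v)))) ->
    T (troot t) = T' (troot t') ->
  exists f : V -> V',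
  [/\ f (troot t) = troot t', forall v, T' (f v) = T v
    & forall v w, is_child t v w ->
        f w = nth (troot t') (sorted_kids t' T' (f v))
                  (index w (sorted_kids t T v))].
Proof.
move=> ht TE TE' rE; have [d [dr dS _]] := depth_exists ht.
have kT (U : finType) (s : predtree A U) S u :
    map S (sorted_kids s S u) = sort (@rle A) (map S (kids s u)).
  by rewrite sort_map.
pose parent v := odflt (troot t) [pick u | is_child t u v].
have parentE u v : is_child t u v -> parent v = u.
  move=> uv; rewrite /parent; case: pickP => [w wv|/(_ u)]; last by rewrite uv.
  exact: (parent_uniq ht wv uv).
pose F := fix F n v := if n is n'.+1 then
  nth (troot t') (sorted_kids t' T' (F n' (parent v)))
      (index v (sorted_kids t T (parent v))) else troot t'.
pose f v := F (d v) v.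
have fr : f (troot t) = troot t' by rewrite /f dr.
have fS v w : is_child t v w -> f w = nth (troot t') (sorted_kids t' T' (f v))
                  (index w (sorted_kids t T v)).
  by move=> vw; rewrite {1}/f (dS _ _ vw) /= (parentE _ _ vw).
exists f; split=> //.
apply: (tree_ind ht) => [|v w vw IH]; first by rewrite fr.
(* Equal codes at [v] and [f v] have equal sorted lists of child codes, so matching by place
   preserves the code. *)
have kE : map T' (sorted_kids t' T' (f v)) = map T (sorted_kids t T v).
  by rewrite !kT; have := IH; rewrite TE TE' => -[].
have iw : index w (sorted_kids t T v) < size (sorted_kids t T v).
  by rewrite index_mem mem_sort mem_kids.
rewrite (fS _ _ vw) -(nth_map _ (T w)); last first.
  by rewrite -(size_map T') kE size_map.
by rewrite kE (nth_map w) // nth_index // -index_mem.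
Qed.

(** Descending in both directions gives two maps that preserve places among sorted siblings;
    induction from the root shows them mutually inverse. *)
Lemma code_isomorphism (V V' : finType) (t : predtree A V) (t' : predtree A V') :
  is_tree t -> is_tree t' -> code t = code t' -> exists f, isomorphism t t' f.
Proof.
move=> ht ht' tt'.
have [T [Tr TE]] := code_spec ht; have [T' [Tr' TE']] := code_spec ht'.
have rE : T (troot t) = T' (troot t') by rewrite Tr Tr'.
(* Stated for arbitrary trees so that it serves both directions. *)
have half (U U' : finType) (s : predtree A U) (s' : predtree A U') S S' f :
    (forall v, S v = Node (decor s v) (sort (@rle A) (map S (kids s v)))) ->
    (forall v, S' v = Node (decor s' v) (sort (@rle A) (map S' (kids s' v)))) ->
    (forall v, S' (f v) = S v) ->
    (forall v w, is_child s v w ->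
        f w = nth (troot s') (sorted_kids s' S' (f v))
                  (index w (sorted_kids s S v))) ->
    forall v w, is_child s v w -> is_child s' (f v) (f w) /\
      index (f w) (sorted_kids s' S' (f v)) = index w (sorted_kids s S v).
  move=> SE SE' fS fn v w vw.
  have iw : index w (sorted_kids s S v) < size (sorted_kids s' S' (f v)).
    have : size (sorted_kids s' S' (f v)) = size (sorted_kids s S v).
      have := fS v; rewrite SE SE' => -[_ /(congr1 size)].
      by rewrite !size_sort !size_map.
    by move=> ->; rewrite index_mem mem_sort mem_kids.
  rewrite (fn _ _ vw) index_uniq ?sort_uniq ?kids_uniq //; split=> //.
  by rewrite -mem_kids -(mem_sort (relpre S' (@rle A))) mem_nth.
have [f [fr fT fn]] := code_descent ht TE TE' rE.
have [g [gr gT gn]] := code_descent ht' TE' TE (esym rE).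
have fc := half _ _ _ _ _ _ _ TE TE' fT fn.
have gc := half _ _ _ _ _ _ _ TE' TE gT gn.
have fK : cancel f g.
  apply: (tree_ind ht) => [|v w vw IH]; first by rewrite fr gr.
  have [fvw ifw] := fc _ _ vw.
  by rewrite (gn _ _ fvw) IH ifw nth_index // mem_sort mem_kids.
have gK : cancel g f.
  apply: (tree_ind ht') => [|v w vw IH]; first by rewrite gr fr.
  have [gvw igw] := gc _ _ vw.
  by rewrite (fn _ _ gvw) IH igw nth_index // mem_sort mem_kids.
exists f; split=> // [|u v|v]; first by exists g.
  by apply/idP/idP => [/gc[]|/fc[]]; rewrite ?fK.
by have := fT v; rewrite TE TE' => -[].
Qed.

Lemma tree_isoP (V : finType) (t t' : predtree A V) :
  is_tree t -> is_tree t' -> tree_iso t t' = (code t == code t').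
Proof.
move=> ht ht'; apply/existsP/eqP => [[f /and3P[/eqP fr /forallP fc /forallP fd]]|].
  apply: (@isomorphism_code _ _ _ _ _ f); split=> // [|u v|v].
  - by exists (f^-1)%g; [apply: permK | apply: permKV].
  - by apply/eqP; move/forallP: (fc u).
  - exact/eqP.
move=> /(code_isomorphism ht ht')[f [/bij_inj fI fr fc fd]].
exists (perm fI); apply/and3P; split; first by rewrite permE fr.
  by apply/forallP=> u; apply/forallP=> v; rewrite !permE fc.
by apply/forallP=> v; rewrite !permE fd.
Qed.

End CodeIsomorphism.

(** * Realizing an ordered tree as a digraph on its node addresses *)

Section Positions.
Variable A : finType.
Implicit Types c : rtree A.

(* A node is addressed by the list of child indices leading to it from the
   root. *)
Fixpoint positions c : seq (seq nat) :=
  let: Node _ s := c in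
  [::] :: [seq i :: p | i <- iota 0 (size s), p <- nth [::] (map positions s) i].

Fixpoint subtree c (p : seq nat) : rtree A :=
  if p is i :: q then subtree (nth c (children c) i) q else c.

Definition node_label c := (rlabel c, arity (size (children c))).

Lemma map_node_label c : map (node_label \o subtree c) (positions c) = labels c.
Proof.
elim/rtree_nth_ind: c => a s IH /=; congr (_ :: _).
rewrite map_flatten -map_comp -[in RHS](mkseq_nth (Node a [::]) s) -map_comp.
congr flatten; apply/eq_in_map => i; rewrite mem_iota add0n /= => lt_is.
rewrite -map_comp (nth_map (Node a [::])) // -IH //; apply: eq_map => p /=.
by rewrite (set_nth_default (Node a [::])).
Qed.

Lemma size_positions c : size (positions c) = size (labels c).
Proof. by rewrite -map_node_label size_map. Qed.

Lemma mem_positions_cons c i q :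
  (i :: q \in positions c) =
  (i < size (children c)) && (q \in positions (nth c (children c) i)).
Proof.
case: c => a s /=; rewrite inE /=; apply/allpairsPdep/andP.
  case=> j [p []]; rewrite mem_iota add0n /= => lt_js + [-> ->].
  by rewrite (nth_map (Node a s)).
case=> lt_is qs; exists i, q; rewrite mem_iota add0n lt_is.
by rewrite (nth_map (Node a s)).
Qed.

Lemma nil_positions c : [::] \in positions c.
Proof. by case: c => a s; rewrite /= mem_head. Qed.

Lemma mem_positions_rcons c p i :
  (rcons p i \in positions c) =
  (p \in positions c) && (i < size (children (subtree c p))).
Proof.
elim: p c => [|j p IHp] c /=; last by rewrite !mem_positions_cons IHp andbA.
by rewrite mem_positions_cons !nil_positions andbT.
Qed.

Lemma positions_uniq c : uniq (positions c).
Proof.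
elim/rtree_nth_ind: c => a s IH /=; apply/andP; split.
  by apply/allpairsPdep=> -[i [p []]].
apply: allpairs_uniq_dep; first exact: iota_uniq.
  move=> i; rewrite mem_iota add0n => /= lt_is.
  by rewrite (nth_map (Node a [::])) // IH.
by move=> [i p] [j q] _ _ /= [-> ->].
Qed.

Lemma subtree_rcons c p i :
    i < size (children (subtree c p)) ->
  subtree c (rcons p i) = nth (subtree c p) (children (subtree c p)) i.
Proof. by elim: p c => [|j p IHp] c //=; apply: IHp. Qed.

Lemma canonical_subtree c p :
  p \in positions c -> canonical c -> canonical (subtree c p).
Proof.
elim: p c => [|j p IHp] c //=; rewrite mem_positions_cons => /andP[lt_jc pc].
case: c lt_jc pc => a s lt_js pc /= /andP[_ /allP cs].
by apply: IHp => //; apply/cs/mem_nth.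
Qed.

Variables (c : rtree A) (n : nat) (sz_c : size (positions c) = n).

Definition address (v : 'I_n) : seq nat := nth [::] (positions c) v.

Lemma map_address_enum : map address (enum 'I_n) = positions c.
Proof.
rewrite (map_comp (nth [::] (positions c)) (@nat_of_ord n)).
by rewrite val_enum_ord -sz_c; apply: mkseq_nth.
Qed.

Lemma address_inj : injective address.
Proof.
move=> u v /eqP; rewrite nth_uniq ?sz_c ?positions_uniq //.
by move/eqP/val_inj.
Qed.

Lemma mem_address v : address v \in positions c.
Proof. by rewrite mem_nth ?sz_c. Qed.

Lemma address_surj p : p \in positions c -> exists v, address v = p.
Proof. by rewrite -map_address_enum => /mapP[v _ ->]; exists v. Qed.

Fact positions_gt0 : 0 < n.
Proof. by rewrite -sz_c; case: (positions c) (nil_positions c). Qed.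

(** Deleting the last index of a nonempty address gives the parent. The root is the ordinal 0
    because [positions] lists [[::]] first. *)
Definition position_tree : predtree A 'I_n :=
  ([set x : 'I_n * 'I_n | (address x.2 != [::]) &&
      (address x.1 == take (size (address x.2)).-1 (address x.2))],
   Ordinal positions_gt0,
   [ffun v => rlabel (subtree c (address v))]).

Lemma position_childP u v :
  reflect (exists i, address v = rcons (address u) i)
          (is_child position_tree u v).
Proof.
rewrite /is_child /arcs inE /=; apply: (iffP andP) => [[]|[i ->]].
  case/lastP: (address v) => // p i _.
  by rewrite size_rcons -cats1 take_size_cat // => /eqP->; exists i; rewrite cats1.
by rewrite size_rcons -cats1 take_size_cat //; case: (address u).
Qed.

Lemma address_root : address (troot position_tree) = [::].
Proof. by rewrite /address /=; case: (c). Qed.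

Lemma position_parent p i v : address v = rcons p i ->
  exists2 u, address u = p & is_child position_tree u v.
Proof.
move=> vE; have := mem_address v; rewrite vE mem_positions_rcons.
case/andP=> /address_surj[u uE] _; exists u => //.
by apply/position_childP; exists i; rewrite uE.
Qed.

Lemma position_is_tree : is_tree position_tree.
Proof.
apply/andP; split; apply/forallP=> v.
  move: {2}(address v) (erefl (address v)) => p.
  elim/last_ind: p v => [|p i IHp] v vE.
    have -> : v = troot position_tree by apply: address_inj; rewrite address_root.
    exact: connect0.
  have [u uE uv] := position_parent vE.
  exact: connect_trans (IHp u uE) (connect1 uv).
have [->|vr] := eqVneq v (troot position_tree).
  rewrite cards_eq0; apply/eqP/setP=> u; rewrite !inE.
  apply/position_childP=> -[i]; rewrite address_root.
  by case: (address u).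
apply/cards1P; case/lastP E: (address v) => [|p i].
  by case/eqP: vr; apply: address_inj; rewrite address_root.
have [u uE uv] := position_parent E; exists u; apply/setP=> w; rewrite !inE.
apply/idP/eqP => [/position_childP[j]|-> //].
rewrite E => /rcons_inj[pE _]; apply: address_inj; by rewrite uE -pE.
Qed.

Lemma position_kids v :
  perm_eq (map address (kids position_tree v))
    [seq rcons (address v) i
       | i <- iota 0 (size (children (subtree c (address v))))].
Proof.
apply: uniq_perm.
- by rewrite map_inj_uniq ?kids_uniq //; apply: address_inj.
- by rewrite map_inj_uniq ?iota_uniq // => i j /rcons_inj[].
move=> p; apply/mapP/mapP => [[w]|[i]].
  rewrite mem_kids => /position_childP[i wE] pE; exists i; last by rewrite pE.
  have := mem_address w; rewrite wE mem_positions_rcons => /andP[_].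
  by rewrite mem_iota.
rewrite mem_iota /= add0n => lt_i pE.
have : p \in positions c by rewrite pE mem_positions_rcons mem_address.
case/address_surj=> w wE; exists w => //.
by rewrite mem_kids; apply/position_childP; exists i; rewrite wE.
Qed.

Lemma position_label v :
  (decor position_tree v, arity (fertility position_tree v)) =
  node_label (subtree c (address v)).
Proof.
rewrite -size_kids -(size_map address) (perm_size (position_kids v)).
by rewrite size_map size_iota ffunE.
Qed.

(** In a canonical tree the children are already sorted, so the sorting done by [code] restores
    their order. *)
Lemma position_code : canonical c -> code position_tree = c.
Proof.
move=> cc; have [T [<- TE]] := code_spec position_is_tree.
suff TP d v : subtree c (address v) = d -> T v = d.
  by apply: TP; rewrite address_root.
elim/rtree_nth_ind: d v => a s IH v vE; rewrite TE.
have -> : decor position_tree v = a by rewrite ffunE vE.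
congr (Node _ _).
have := canonical_subtree (mem_address v) cc; rewrite vE => /= /andP[ss _].
rewrite -[RHS](sorted_sort (@rle_trans A) ss).
apply/perm_sortP; [exact: rle_total | exact: rle_trans | exact: rle_anti |].
(* The last index of a child's address says which entry of [s] it carries. *)
have -> : map T (kids position_tree v) =
    map (fun p => nth (Node a [::]) s (last 0 p))
        (map address (kids position_tree v)).
  rewrite -map_comp; apply/eq_in_map => w.
  rewrite mem_kids => /position_childP[i wE] /=; rewrite wE last_rcons.
  have := mem_address w; rewrite wE mem_positions_rcons vE => /andP[_ /= lt_is].
  apply: IH => //; rewrite wE subtree_rcons vE //=.
  exact: set_nth_default.
rewrite (permPl (perm_map _ (position_kids v))) vE -map_comp.
rewrite (eq_map (g := nth (Node a [::]) s)) => [|i]; last by rewrite /= last_rcons.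
by rewrite -[in X in perm_eq _ X](mkseq_nth (Node a [::]) s).
Qed.

End Positions.

(** * Isomorphism classes of a given profile as canonical ordered trees *)

Section TreeClasses.
Variable A : finType.

Definition vertex_labels (V : finType) (t : predtree A V) : seq (A * zgem1) :=
  [seq (decor t v, arity (fertility t v)) | v <- enum V].

(** The tree is isomorphic to the position tree of its code, whose vertices are enumerated in the
    order of [labels]. *)
Lemma perm_vertex_labels (V : finType) (t : predtree A V) :
  is_tree t -> perm_eq (vertex_labels t) (labels (code t)).
Proof.
move=> ht; set c := code t.
pose t' := position_tree (erefl (size (positions c))).
have [|f tf] := code_isomorphism ht (position_is_tree (erefl (size (positions c)))).
  by rewrite position_code // canonical_code.
have [[g fK gK] _ _ _] := tf.
have -> : vertex_labels t =
    map (fun u => (decor t' u, arity (fertility t' u))) (map f (enum V)).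
  by rewrite -map_comp; apply: eq_map => v; rewrite /= (isomorphism_label v tf).
have /(perm_map (fun u => (decor t' u, arity (fertility t' u)))) :
    perm_eq (map f (enum V)) (enum 'I_(size (positions c))).
  apply: uniq_perm; rewrite ?enum_uniq //.
    by rewrite map_inj_uniq ?enum_uniq //; apply: can_inj fK.
  by move=> u; rewrite -[u]gK mem_map ?mem_enum //; apply: can_inj fK.
move/permPl->.
rewrite (eq_map (g := (@node_label A \o subtree c) \o @address _ c _)).
  by rewrite map_comp (map_address_enum (erefl _)) map_node_label.
by move=> u; apply: position_label.
Qed.

Lemma has_profileP (V : finType) (t : predtree A V) (k : multiindex A) :
  is_tree t -> (has_profile t k <-> profile (code t) = k).
Proof.
move=> ht.
have E a j : profile (code t) (a, j) =
   #|[set v | (decor t v == a) && ((fertility t v)%:Z == val j + 1)%R]|.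
  rewrite tallyE -(seq.permP (perm_vertex_labels ht)) count_map.
  rewrite -sum1_count big_enum_cond -sum1_card.
  by apply: eq_bigl => v; rewrite !inE /= xpair_eqE arity_eq.
split=> [tk|<- a j]; last exact: E.
by apply/fsfunP=> -[a j]; rewrite E -tk.
Qed.

Definition codes (k : multiindex A) : seq (rtree A) :=
  undup [seq code t | t <- enum (trees_of_profile k)].

Lemma codes_uniq k : uniq (codes k).
Proof. exact: undup_uniq. Qed.

(** Conversely, a canonical [c] of profile [k] is the code of its position tree, which has the
    required [mlen k] vertices. *)
Lemma mem_codes k c : (c \in codes k) = canonical c && (profile c == k).
Proof.
rewrite mem_undup; apply/mapP/andP => [[t]|[cc /eqP <-]].
  rewrite mem_enum inE => /andP[ht /asboolP/(has_profileP _ ht) tk] ->.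
  by rewrite canonical_code; split=> //; apply/eqP.
have sz : size (positions c) = mlen (profile c) by rewrite size_positions mlen_profile.
exists (position_tree sz); last by rewrite position_code.
rewrite mem_enum inE position_is_tree; apply/asboolP.
by apply/has_profileP; rewrite ?position_is_tree // position_code.
Qed.

(** Two trees lie in the same class exactly when their codes agree, so removing duplicates from the
    list of classes or of codes leaves the same number. *)
Lemma num_treesE k : num_trees k = size (codes k).
Proof.
rewrite /num_trees /tree_classes /equivalence_partition /codes.
have : {in trees_of_profile k, forall t, is_tree t}.
  by move=> t; rewrite inE => /andP[].
move: (trees_of_profile k) => D DT.
set cls := (fun t => [set u in D | tree_iso t u]).
have clsE t u : t \in D -> u \in D -> (cls t == cls u) = (code t == code u).
  move=> tD uD; apply/eqP/eqP => [/setP/(_ u)|tu].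
    by rewrite !inE uD !tree_isoP ?DT // eqxx => /eqP.
  apply/setP=> w; rewrite !inE; case: (boolP (w \in D)) => //= wD.
  by rewrite !tree_isoP ?DT // tu.
have -> : #|cls @: D| = size (undup (map cls (enum D))).
  rewrite cardE; apply/perm_size/uniq_perm; rewrite ?enum_uniq ?undup_uniq //.
  move=> C; rewrite mem_enum mem_undup; apply/imsetP/mapP.
    by case=> t tD ->; exists t; rewrite ?mem_enum.
  by case=> t; rewrite mem_enum => tD ->; exists t.
have : {subset enum D <= D} by move=> t; rewrite mem_enum.
elim: (enum D) => //= t s IH sD.
have tD : t \in D by apply: sD; rewrite mem_head.
have {}sD : {subset s <= D} by move=> u us; apply: sD; rewrite inE us orbT.
have -> : (cls t \in map cls s) = (code t \in map (@code _ _) s).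
  by apply/mapP/mapP=> -[u us /eqP tu]; exists u => //; apply/eqP;
    [rewrite -clsE // sD | rewrite clsE // sD].
by case: ifP => _ /=; rewrite IH.
Qed.

End TreeClasses.

(** * Root removal and grafting *)

Section Grafting.
Variables (A : finType) (k : multiindex A).
Implicit Types (a : A) (j : zgem1) (nu : kfamily A) (c : rtree A).

Lemma codes_label a j c : c \in codes k -> node_label c = (a, j) ->
  1 <= k (a, j).
Proof.
rewrite mem_codes => /andP[_ /eqP <-]; case: c => b s [-> <-].
by rewrite profile_Node /munit eqxx.
Qed.

Lemma codes_family a j c : c \in codes k -> node_label c = (a, j) ->
  ((fam_size (family c))%:Z = val j + 1)%R /\
  forall q, fam_sum (family c) q = k q - munit (a, j) q.
Proof.
rewrite mem_codes => /andP[_ /eqP <-]; case: c => b s [-> <-].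
(* The truncated subtraction is exact, since [k q] is a sum containing the root term. *)
split=> [|q]; last by rewrite profile_Node addKn.
by rewrite fam_size_family /=; lia.
Qed.

(** The product counts the multisets of canonical trees with [nu l] members of profile [l]; sorting
    such a multiset and grafting it on a root [a] yields each counted tree once. *)
Lemma prod_Mlt a j nu :
    1 <= k (a, j) -> ((fam_size nu)%:Z = val j + 1)%R ->
    (forall q, fam_sum nu q = k q - munit (a, j) q) ->
  \prod_(l <- finsupp nu) Mlt (num_trees (val l)) (nu l) =
  count (fun c => (node_label c == (a, j)) && (family c == nu)) (codes k).
Proof.
move=> kaj nuj nuk.
pose C (l : Kminus1 A) := codes (val l).
have CP l : uniq (C l) by apply: codes_uniq.
have memC l c : (c \in C l) = canonical c && (profileK c == l).
  by rewrite mem_codes.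
under eq_bigr do rewrite num_treesE.
rewrite -(size_multifamilies C) -size_filter.
set E := multifamilies C nu (finsupp nu).
have countE s : count (perm_eq s) E =
    all (@canonical A) s && (tally (map (@profileK A) s) == nu).
  rewrite (count_multifamilies nu CP memC) ?fset_uniq //.
  congr (nat_of_bool (_ && _)); apply/andP/eqP => [[/allP s1 /allP s2]|<-].
    apply/fsfunP=> l; rewrite tallyE.
    have [/s2/eqP//|ln] := boolP (l \in finsupp nu).
    rewrite (fsfun_dflt ln); apply/count_memPn.
    by apply: contra ln => /mapP[x /s1 + ->].
  split; apply/allP => x xs; last by rewrite -tallyE.
  by rewrite mem_finsupp_tally map_f.
rewrite -(size_map (fun u => Node a (sort (@rle A) u))).
(* The two lists have equal length because every tree occurs equally often in both; the list
   filtered from [codes k] has no repetitions, so there the count is a membership bit. *)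
apply/esym/perm_size; apply/allP => -[b s] _; apply/eqP.
rewrite (count_uniq_mem _ (filter_uniq _ (codes_uniq k))) mem_filter mem_codes.
rewrite count_map /node_label /= xpair_eqE.
have [->|ba] := eqVneq b a; last first.
  rewrite (@eq_count _ _ pred0) ?count_pred0 // => u /=.
  by apply: contraNF ba => /eqP[->].
have [ss|ss] := boolP (sorted (@rle A) s); last first.
  rewrite !andbF (@eq_count _ _ pred0) ?count_pred0 // => u /=.
  by apply: contraNF ss => /eqP[<-]; apply: sort_sorted (@rle_total A) _.
(* For sorted [s], the multisets that sort to [s] are its permutations. *)
rewrite (@eq_count _ _ (perm_eq s)) => [|u]; last first.
  rewrite /= -[s in LHS](sorted_sort (@rle_trans A) ss) perm_sym.
  have pE := perm_sortP (@rle_total A) (@rle_trans A) (@rle_anti A).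
  by apply/eqP/idP=> [[/pE]|/pE->].
rewrite countE; case: all; rewrite ?andbF //=.
rewrite -[tally _]/(family (Node a s)).
case: (family _ =P nu) => [fE|]; rewrite ?andbF ?andbT //.
have szs : size s = fam_size nu by rewrite -fE fam_size_family.
have js : arity (size s) == j by rewrite arity_eq szs nuj.
(* Adding the root back recovers [k]; undoing the truncated subtraction at [(a, j)] relies on
   [1 <= k (a, j)]. *)
rewrite js; apply/eqP; rewrite eqb1; apply/eqP/fsfunP => q.
rewrite profile_Node fE nuk (eqP js) subnKC // /munit.
by case: eqP => [->|].
Qed.

End Grafting.

(** * Summation over fibres and the final recursion *)

Local Open Scope classical_set_scope.

(** The set [D] may be infinite, but only the finitely many values of [f] on [s] contribute. *)
Lemma fsbig_count (I : choiceType) (X : eqType) (f : X -> I) (s : seq X)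
    (D : set I) :
    {in s, forall x, D (f x)} ->
  \big[addn/0]_(i \in D) count (fun x => f x == i) s = size s.
Proof.
move=> sD; pose r := finsupp (tally (map f s)).
have rD i : i \in r -> D i.
  by rewrite mem_finsupp_tally => /mapP[x /sD + ->].
rewrite (fsbigE r) ?fset_uniq //; last first.
  move=> i _; rewrite mem_finsupp_tally => /count_memPn.
  by rewrite count_map.
rewrite big_seq_cond (eq_bigl (fun i => i \in r)) => [|i]; last first.
  by rewrite andb_idr // => /rD; rewrite inE.
rewrite -big_seq -(size_map f s) -sum1_size.
rewrite -(sum_finsupp_tally_nat (map f s)); apply: eq_bigr => i _.
by rewrite muln1 tallyE count_map.
Qed.

Theorem theorem4p2 (A : finType) (k : multiindex A) (hk : mwt k = (-1)%R) :
  num_trees k =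
  \sum_(a : A)
    \big[addn/0]_(j \in [set j : zgem1 | 1 <= k (a, j)])
      \big[addn/0]_(nu \in [set nu : kfamily A |
          ((fam_size nu)%:Z = val j + 1)%R /\
          forall q, fam_sum nu q = k q - munit (a, j) q])
        \prod_(l <- finsupp nu) Mlt (num_trees (val l)) (nu l).
Proof.
(* The canonical trees are sorted by root decoration, then by root arity, then by the family of
   child profiles, matching the three nested sums. *)
rewrite num_treesE -sum1_size (partition_big (@rlabel A) predT) //.
apply: eq_bigr => a _; rewrite sum1_count -size_filter.
rewrite -(@fsbig_count _ _ (fun c => arity (size (children c))) _
  [set j : zgem1 | 1 <= k (a, j)]); last first.
  move=> c; rewrite mem_filter => /andP[/eqP ca ck] /=.
  by apply: codes_label ck _; rewrite /node_label ca.
apply: eq_fsbigr => j; rewrite inE /= => kaj.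
rewrite count_filter -size_filter.
rewrite -(@fsbig_count _ _ (@family A) _ [set nu : kfamily A |
          ((fam_size nu)%:Z = val j + 1)%R /\
          forall q, fam_sum nu q = k q - munit (a, j) q]); last first.
  move=> c; rewrite mem_filter => /andP[/andP[/= /eqP cj /eqP ca] ck] /=.
  by apply: codes_family ck _; rewrite /node_label ca cj.
apply: eq_fsbigr => nu; rewrite inE /= => -[nuj nuk].
rewrite (prod_Mlt kaj nuj nuk) count_filter; apply: eq_count => c /=.
by rewrite /node_label xpair_eqE [RHS]andbC; congr (_ && _); rewrite andbC.
Qed.
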